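(* Let $B$ be a commutative ring, let $A$ be a ring that is a free right $B$-module of rank $m$, and let $r\ge 1$. Assume there is an ordered basis $e=(e_1,\dots,e_m)$ of $A$ as a right $B$-module such that (i) $e_i$ is invertible in $A$ for every $i$; (ii) $e_i^{-1}Be_i\subset B$ for every $i$. Then $\mathrm{Sdet}_{\mathrm{M}(r,A)}^B(a)\in Z(A)\cap B$ for all $a\in \mathrm{M}(r,A)$, where $Z(A)$ is the center of $A$.
   Context: Rings have a multiplicative unit; $\mathrm{M}(k,R)$ is the ring of $k\times k$ matrices over $R$. ''$A$ is a free right $B$-module of rank $m$'' means that $B$ is a subring of $A$ and $A=\bigoplus_{i=1}^m e_iB$ for some ordered basis $e=(e_1,\dots,e_m)$. For such rings the left regular representation $L_e:A\to \mathrm{M}(m,B)$, $a\mapsto(b_{ij})$, is defined by $ae_j=\sum_ie_ib_{ij}$. Also $\mathrm{M}(r,A)=\bigoplus_{i=1}^m(e_iI_r)\mathrm{M}(r,B)$ is a free right $\mathrm{M}(r,B)$-module of rank $m$; let $L:\mathrm{M}(r,A)\to \mathrm{M}(m,\mathrm{M}(r,B))$ be a left regular representation (e.g. with respect to $(e_1I_r,\dots,e_mI_r)$). The Study-type determinant is $\mathrm{Sdet}_{\mathrm{M}(r,A)}^B:=\det\circ\,\iota\circ L$, where $\iota:\mathrm{M}(m,\mathrm{M}(r,B))\hookrightarrow \mathrm{M}(mr,B)$ is the inclusion (block matrices viewed as $mr\times mr$ matrices) and $\det:\mathrm{M}(mr,B)\to B$ is the determinant; it does not depend on the choice of basis. 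*)

(* Defs.v *)
From HB Require Import structures.
From mathcomp Require Import all_boot all_order all_algebra.
Set Implicit Arguments.
Unset Strict Implicit.
Unset Printing Implicit Defensive.
Import GRing.Theory.
Local Open Scope ring_scope.

(* A subring B of A is given by an injective ring morphism phi : B -> A, so   *)
(* that the same definitions cover the inclusion map_mx phi of M(r, B) into   *)
(* M(r, A).                                                                   *)
Section RightBasis.
Variables (B A : pzRingType) (phi : B -> A) (m : nat).
Implicit Types (e : 'I_m -> A) (a : A) (b : 'cV[B]_m).

Definition rcomb e b : A := \sum_(i < m) e i * phi (b i 0).

Definition right_basis e : Prop := forall a, exists! b, a = rcomb e b.

Lemma right_basis_ex e (he : right_basis e) a : exists b, a == rcomb e b.
Proof. by have [b [-> _]] := he a; exists b. Qed.

Definition rcoord e (he : right_basis e) a : 'cV[B]_m :=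
  xchoose (right_basis_ex he a).

Definition left_regular e (he : right_basis e) a : 'M[B]_m :=
  \matrix_(i, j) rcoord he (a * e j) i 0.

Lemma rcombK e (he : right_basis e) a : a = rcomb e (rcoord he a).
Proof. exact/eqP/(xchooseP (right_basis_ex he a)). Qed.

Lemma left_regularE e (he : right_basis e) a j :
  a * e j = \sum_(i < m) e i * phi (left_regular he a i j).
Proof.
by rewrite {1}[a * e j](rcombK he); apply: eq_bigr => i _; rewrite mxE.
Qed.

End RightBasis.

Definition inverse_of (A : pzRingType) (x y : A) : Prop := x * y = 1 /\ y * x = 1.

Definition in_center (A : pzRingType) (z : A) : Prop :=
  forall x : A, GRing.comm z x.

Definition in_subring (B A : pzRingType) (phi : B -> A) (z : A) : Prop :=
  exists b : B, z = phi b.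

(* M(m, M(r, B)) -> M(mr, B); mxblock has size \sum_(i < m) r, that is, m * r. *)
Definition flatten_mx (B : pzRingType) (m r : nat) (M : 'M['M[B]_r]_m) :
    'M[B]_(\sum_(i < m) r) :=
  \mxblock_(i < m, j < m) M i j.

(* The basis E of M(r, A) over M(r, B) is arbitrary: the value of Sdet does   *)
(* not depend on it.                                                          *)
Definition Sdet (B : comPzRingType) (A : pzRingType) (phi : B -> A) (m r : nat)
    (E : 'I_m -> 'M[A]_r) (hE : right_basis (map_mx phi) E) (a : 'M[A]_r) : B :=
  \det (flatten_mx (left_regular hE a)).

(* Main.v *)
Require Import Defs.
From HB Require Import structures.
From mathcomp Require Import all_boot all_order all_algebra.
Set Implicit Arguments.
Unset Strict Implicit.
Unset Printing Implicit Defensive.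
Import GRing.Theory.
Local Open Scope ring_scope.

(** Let sigma be the endomorphism of B with phi b * e_i = e_i * phi (sigma b).
Write a basis of M(r, A) as a row vector E and put u = e_i I_r, so that
a E = E L(a) and E u = E P.  Expanding E u^-1 in the basis shows that P is
right invertible, hence that det P is a unit of B.  Computing a E u in two ways
gives L(a) P = P sigma(L(a)), so det L(a) = sigma (det L(a)), that is,
det L(a) commutes with e_i.  It commutes with B as B is commutative, hence
with all of A. *)

(** Conjugation by [u] preserves the image of [phi]; injectivity of [phi] lets the ring laws of [s]
    be checked in [A], where [u * f = 1] cancels between the factors of a product. *)
Lemma conj_rmorphism (B A : pzRingType) (phi : {rmorphism B -> A})
    (phi_inj : injective phi) (u f : A) (uf : inverse_of u f)
    (conj_sub : forall b, in_subring phi (f * phi b * u)) :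
  exists s : {rmorphism B -> B}, forall b, phi b * u = u * phi (s b).
Proof.
have [uf1 fu1] := uf.
have ex b : exists c, f * phi b * u == phi c.
  by have [c ->] := conj_sub b; exists c.
pose s b := xchoose (ex b).
have sE b : phi (s b) = f * phi b * u by rewrite (eqP (xchooseP (ex b))).
have s_zmod : zmod_morphism s.
  by move=> b c; apply: phi_inj; rewrite rmorphB !sE rmorphB mulrBr mulrBl.
have s_monoid : monoid_morphism s.
  split=> [|b c]; apply: phi_inj; first by rewrite sE rmorph1 mulr1.
  by rewrite rmorphM !sE rmorphM !mulrA -[f * phi b * u * f]mulrA uf1 mulr1.
pose S : {rmorphism B -> B} := HB.pack_for {rmorphism B -> B} s
  (GRing.isZmodMorphism.Build B B s s_zmod)
  (GRing.isMonoidMorphism.Build B B s s_monoid).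
by exists S => b; rewrite sE !mulrA uf1 mul1r.
Qed.

(** Uniqueness of coordinates, applied column by column. It reduces matrix identities over [C] to
    identities between rows over [D]. *)
Lemma right_basis_mulmx_inj (C D : pzRingType) (psi : {rmorphism C -> D})
    (m n : nat) (E : 'I_m -> D) (hE : right_basis psi E) (M N : 'M[C]_(m, n)) :
  (\row_j E j) *m map_mx psi M = (\row_j E j) *m map_mx psi N -> M = N.
Proof.
move=> eqMN; apply/matrixP => i j.
have rcombE (K : 'M[C]_(m, n)) :
    rcomb psi E (col j K) = ((\row_k E k) *m map_mx psi K) 0 j.
  by rewrite /rcomb !mxE; apply: eq_bigr => k _; rewrite !mxE.
have [c [_ c_uniq]] := hE (rcomb psi E (col j M)).
have eqcol : col j M = col j N.
  by rewrite -(c_uniq (col j M)) // -(c_uniq (col j N)) // !rcombE eqMN.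
by move/colP: eqcol => /(_ i); rewrite !mxE.
Qed.

Lemma right_basis_mulmx_ex (C D : pzRingType) (psi : {rmorphism C -> D})
    (m n : nat) (E : 'I_m -> D) (hE : right_basis psi E) (v : 'rV[D]_n) :
  exists M : 'M[C]_(m, n), v = (\row_j E j) *m map_mx psi M.
Proof.
exists (\matrix_(i, j) rcoord hE (v 0 j) i 0); apply/rowP => j.
rewrite {1}(rcombK hE (v 0 j)) /rcomb mxE.
by apply: eq_bigr => i _; rewrite !mxE.
Qed.

(** Serves at two levels: with [phi] it lifts the relation from [A] to ['M[A]_r], and with
    [map_mx phi] it lifts that one to matrices of blocks. *)
Lemma map_mx_conj (C D : pzRingType) (psi : C -> D) (u : D) (s : C -> C)
    (su : forall c, psi c * u = u * psi (s c)) (m n : nat) (M : 'M[C]_(m, n)) :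
  map_mx psi M *m u%:M = u%:M *m map_mx psi (map_mx s M).
Proof.
apply/matrixP => i j; rewrite mul_scalar_mx !mxE (bigD1 j) //= !mxE eqxx.
rewrite mulr1n su big1 ?addr0 // => k kj.
by rewrite !mxE (negPf kj) mulr0n mulr0.
Qed.

(** [C] will be a noncommutative matrix ring, so invertibility of [P] is recorded by an explicit
    right inverse; determinants are taken only after flattening. *)
Lemma left_regular_conj (C D : pzRingType) (psi : {rmorphism C -> D}) (m : nat)
    (E : 'I_m -> D) (hE : right_basis psi E) (u f : D) (uf : inverse_of u f)
    (s : {rmorphism C -> C})
    (su : forall c, psi c * u = u * psi (s c)) (a : D) :
  exists P Q : 'M[C]_m, P *m Q = 1%:M /\
    left_regular hE a *m P = P *m map_mx s (left_regular hE a).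
Proof.
have [_ fu1] := uf.
pose V := \row_j E j; set L := left_regular hE a.
have aV : a *: V = V *m map_mx psi L.
  by apply/rowP => j; rewrite !mxE (left_regularE hE); apply: eq_bigr => i _;
    rewrite !mxE.
have [P VuP] := right_basis_mulmx_ex hE (V *m u%:M).
have [Q VfQ] := right_basis_mulmx_ex hE (V *m f%:M).
(* The witness comes from [V = (V f) u = V Q u = V u s(Q) = V P s(Q)]. *)
exists P, (map_mx s Q); split; apply: (right_basis_mulmx_inj hE).
  rewrite !map_mxM mulmxA -VuP -mulmxA -(map_mx_conj su) mulmxA -VfQ -mulmxA.
  by rewrite -scalar_mxM fu1 map_mx1.
(* Both sides equal [a V u]: it is [a V P = V L P], and also [V L u = V u s(L) = V P s(L)]. *)
rewrite !map_mxM !mulmxA -VuP -aV -scalemxAl -VuP.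
by rewrite scalemxAl aV -!mulmxA (map_mx_conj su).
Qed.

Lemma flatten_mxM (B : pzRingType) (m r : nat) (M N : 'M['M[B]_r]_m) :
  flatten_mx (M *m N) = flatten_mx M *m flatten_mx N.
Proof.
by rewrite /flatten_mx mul_mxblock; apply/eq_mxblock => i j; rewrite mxE.
Qed.

Lemma flatten_mx1 (B : pzRingType) (m r : nat) :
  flatten_mx (1%:M : 'M['M[B]_r]_m) = 1%:M.
Proof.
rewrite /flatten_mx -mxdiagZ; apply/eq_mxblock => i j.
(* Block-diagonal matrices cast their blocks by [conform_mx], which is the identity here since all
   blocks have size [r]. *)
by rewrite conform_mx_id !mxE; case: eqVneq.
Qed.

Lemma map_flatten_mx (B C : pzRingType) (s : B -> C) (m r : nat)
    (M : 'M['M[B]_r]_m) :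
  map_mx s (flatten_mx M) = flatten_mx (map_mx (map_mx s) M).
Proof. by apply/matrixP => i j; rewrite !mxE. Qed.

Lemma det_flatten_conj (B : comPzRingType) (s : {rmorphism B -> B}) (m r : nat)
    (M P Q : 'M['M[B]_r]_m) :
  P *m Q = 1%:M -> M *m P = P *m map_mx (map_mx s) M ->
  s (\det (flatten_mx M)) = \det (flatten_mx M).
Proof.
move=> PQ MP; have detPQ : \det (flatten_mx P) * \det (flatten_mx Q) = 1.
  by rewrite -det_mulmx -flatten_mxM PQ flatten_mx1 det1.
have := congr1 (fun N => \det (flatten_mx N)) MP.
rewrite /= !flatten_mxM !det_mulmx -map_flatten_mx det_map_mx => detMP.
(* Multiplying by [det Q] cancels [det P], by commutativity of [B]. *)
by rewrite -[RHS]mulr1 -detPQ mulrA detMP mulrAC detPQ mul1r.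
Qed.

Theorem corollary7p3 (B : comPzRingType) (A : pzRingType)
    (phi : {rmorphism B -> A}) (phi_inj : injective phi)
    (m r : nat) (r_gt0 : (0 < r)%N)
    (e : 'I_m -> A) (e_basis : right_basis phi e)
    (e_inv : forall i : 'I_m, exists f : A, inverse_of (e i) f)
    (e_conj : forall (i : 'I_m) (f : A), inverse_of (e i) f ->
      forall b : B, in_subring phi (f * phi b * e i))
    (E : 'I_m -> 'M[A]_r) (E_basis : right_basis (map_mx phi) E)
    (a : 'M[A]_r) :
  in_center (phi (Sdet E_basis a)) /\ in_subring phi (phi (Sdet E_basis a)).
Proof.
split; last by exists (Sdet E_basis a).
have comm_e i : GRing.comm (phi (Sdet E_basis a)) (e i).
  have [f ef] := e_inv i; have [ef1 fe1] := ef.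
  have [s se] := conj_rmorphism phi_inj ef (e_conj i f ef).
  have uf : inverse_of ((e i)%:M : 'M[A]_r) f%:M.
    by split; rewrite -[_ * _]scalar_mxM ?ef1 ?fe1.
  have su := @map_mx_conj _ _ _ _ _ se r r.
  have [P [Q [PQ LP]]] := left_regular_conj E_basis uf su a.
  by rewrite /GRing.comm se /Sdet (det_flatten_conj PQ LP).
move=> x; rewrite (rcombK e_basis x) /rcomb.
apply: commr_sum => i _; apply: commrM; first exact: comm_e.
by rewrite /GRing.comm -!rmorphM mulrC.
Qed.
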